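(* There exists a real number $[x]\in\mathcal{S}_{\mathbb{R}}$ such that for all real numbers $[a]\in\mathcal{S}_{\mathbb{R}}$ we have $[x]+[a]=[a]$.
   Context: Conventions. $\omega=\{0,1,2,\dots\}$, $\omega_+=\omega\setminus\{0\}$, $[a,b]_\omega=\{n\in\omega:a\le n\le b\}$, $[a,\infty]_\omega=\{n\in\omega:n\ge a\}$. A system function $\vartheta:\omega_+\to[2,\infty]_\omega$ is fixed. Contractions. For $f:\omega\to\omega$ and $n\in\omega_+$, the contraction $c_n$ is applicable to $f$ iff $f(n+1)\ge\vartheta(n)$, and then $c_n(f)(n)=f(n)+1$, $c_n(f)(n+1)=f(n+1)-\vartheta(n)$, $c_n(f)(k)=f(k)$ for other $k$. A sequence of contractions is a finite (possibly empty) composition of contractions; it is applicable to $f$ iff each contraction in turn is applicable to the result of the preceding ones. Sign. For $f:\omega\to\omega$, $\sigma(f)=0$ if $f(0)$ is odd and $\sigma(f)=1$ if $f(0)$ is even. Auxiliary functions. $h:\omega\to\omega$ is a primary auxiliary function ($h\in A_p$) if $h(k)<\vartheta(k-1)$ for all $k\ge2$ and for every $N\in\omega_+$ there is $M\ge N+1$ with $h(M)\ne\vartheta(M-1)-1$. It is a secondary auxiliary function ($h\in A_s$) if $h(k)<\vartheta(k-1)$ for all $k\ge2$ and there is $N\in\omega_+$ with $h(M)=\vartheta(M-1)-1$ for all $M\ge N+1$; the least such $N$ is $N^h_{\min}$. Base set. $W_1$ is the set of pairs $(h_p,h_s)\in A_p\times A_s$ such that, with $N=N^{h_s}_{\min}$,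 $h_p(k)=h_s(k)$ for $k<N$, $h_p(N)=h_s(N)+1$, and $h_p(k)=0$ for $k>N$. Two pairs in $W_1$ are equivalent if their first components agree on $\omega_+$ and have the same sign; $F$ is the collection of sets obtained by taking, for each equivalence class, the set of all functions that are components of its pairs. $W_2$ is the set of primary auxiliary functions occurring in no pair of $W_1$; two elements of $W_2$ are equivalent if they agree on $\omega_+$ and have the same sign; $G_2$ is the set of equivalence classes. The base set is $B=F\cup G_2$. Real numbers. For $b\in B$, $r_b$ is the set of $f:\omega\to\omega$ for which there is $h\in b$ such that for every $N\in\omega_+$ some sequence of contractions $\mathcal{C}$ applicable to $f$ satisfies $\mathcal{C}(f)(n)=h(n)$ for all $n\in[0,N]_\omega$. Let $b_1,b_2\in B$ be the elements containing respectively the zero function, and the function with value $1$ at $0$ and $0$ elsewhere. $\mathcal{S}_{\mathbb{R}}$ (the set of real numbers) consists of all $r_b$ with $b\in B\setminus\{b_1,b_2\}$ together with $[0]:=r_{b_1}\cup r_{b_2}$. Put $\mathcal{S}_{\mathbb{R}}^*=\mathcal{S}_{\mathbb{R}}\setminus\{[0]\}$. Distinct real numbers are disjoint. A function lying in some real number is called finite, and $[f]$ denotes the real number containing $f$. For $[a]\in\mathcal{S}_{\mathbb{R}}^*$ all elements have the same sign, denoted $\sigma([a])$. Every real number $[x]$ contains primary auxiliary functions, and they all agree on $\omega_+$; $x_p$ denotes one of them. Order. For $[a],[b]\in\mathcal{S}_{\mathbb{R}}^*$, $[a]\le[b]$ iff one of the following holds: (i) $\sigma([a])<\sigma([b])$;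 (ii) $\sigma([a])=\sigma([b])=1$ and for every $a\in[a]$ there is $b\in[b]$ with $a(n)\le b(n)$ for all $n\in\omega_+$; (iii) $\sigma([a])=\sigma([b])=0$ and for every $b\in[b]$ there is $a\in[a]$ with $a(n)\ge b(n)$ for all $n\in\omega_+$. For $[a]\in\mathcal{S}_{\mathbb{R}}^*$, $[a]\le[0]$ iff $\sigma([a])=0$, and $[0]\le[a]$ iff $\sigma([a])=1$. Finally $[0]\le[0]$ holds. Strict order: $[a]<[b]$ iff not $[b]\le[a]$. Addition. The absolute value $|f|$ of $f:\omega\to\omega$ is the function with $|f|(0)=0$ and $|f|(k)=f(k)$ for $k\in\omega_+$; for a real number, $|[x]|:=[|f|]$ for any $f\in[x]$ (independent of $f$). For finite $f,g$ with $|[f]|>|[g]|$, the set of tracking functions $\mathcal{T}^f_g$ consists of all $\varrho:\omega\to\omega$ for which there is $w\in[f]$ with $w(n)\ge g(n)$ for all $n\in\omega_+$, $\varrho(0)=w(0)$ and $\varrho(n)=w(n)-g(n)$ for all $n\in\omega_+$. If moreover $\sigma(f)\ne\sigma(g)$ or $g\in[0]$, then $\mathcal{T}^f_g$ is non-empty and contained in a single real number $[x]$, and the primary tracking function $\varrho^f_g$ is defined by $\varrho^f_g(0)=f(0)$, $\varrho^f_g(k)=x_p(k)$ for $k\in\omega_+$. For finite $f,g$ the sub-sum $f+g:\omega\to\omega$ is: if $\sigma(f)=\sigma(g)$ and $f,g\notin[0]$, then $(f+g)(0)=f(0)g(0)$ and $(f+g)(k)=f(k)+g(k)$ for $k\in\omega_+$;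 otherwise $f+g$ is the zero function if $|[f]|=|[g]|$, is $\varrho^f_g$ if $|[f]|>|[g]|$, and is $\varrho^g_f$ if $|[f]|<|[g]|$. Addition of real numbers: $[f]+[g]:=[f+g]$ for any $f\in[f]$, $g\in[g]$ (independent of the choice of representatives). *)

(* Defs.v *)
From mathcomp Require Export all_boot.
From mathcomp Require Export boolp classical_sets.

Set Implicit Arguments.
Unset Strict Implicit.
Unset Printing Implicit Defensive.

Local Open Scope nat_scope.
Local Open Scope classical_set_scope.

(* The system function is a total [theta : nat -> nat]; its value at 0 is never
   used below, and [2 <= theta n] for [0 < n] is a hypothesis of the theorem.

   Real numbers are sets of functions [nat -> nat].  A definite description
   "the X such that P X" is rendered as [xget d [set X | P X]], the default [d]
   being returned only if there is no such X. *)

Definition contractible (theta : nat -> nat) (n : nat) (f : nat -> nat) : bool :=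
  theta n <= f n.+1.

Definition contraction (theta : nat -> nat) (n : nat) (f : nat -> nat) :
    nat -> nat :=
  fun k => if k == n then f n + 1
           else if k == n.+1 then f n.+1 - theta n
           else f k.

(* A sequence of contractions is the list of its indices, first applied first. *)
Fixpoint contractions (theta : nat -> nat) (C : seq nat) (f : nat -> nat) :
    nat -> nat :=
  if C is n :: C' then contractions theta C' (contraction theta n f) else f.

Fixpoint applicable (theta : nat -> nat) (C : seq nat) (f : nat -> nat) : bool :=
  if C is n :: C' then
    [&& 0 < n, contractible theta n f & applicable theta C' (contraction theta n f)]
  else true.

Definition sigma (f : nat -> nat) : nat := if odd (f 0) then 0 else 1.

Definition normal_digits (theta h : nat -> nat) : Prop :=
  forall k, 2 <= k -> h k < theta k.-1.

Definition primary (theta h : nat -> nat) : Prop :=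
  normal_digits theta h /\
  forall N, 0 < N -> exists2 M, N.+1 <= M & h M <> (theta M.-1).-1.

Definition maximal_after (theta h : nat -> nat) (N : nat) : Prop :=
  0 < N /\ forall M, N.+1 <= M -> h M = (theta M.-1).-1.

Definition secondary (theta h : nat -> nat) : Prop :=
  normal_digits theta h /\ exists N, maximal_after theta h N.

Definition is_Nmin (theta h : nat -> nat) (N : nat) : Prop :=
  maximal_after theta h N /\ forall N', maximal_after theta h N' -> N <= N'.

Definition W1 (theta : nat -> nat) : set ((nat -> nat) * (nat -> nat)) :=
  [set p | [/\ primary theta p.1, secondary theta p.2 &
     exists N, [/\ is_Nmin theta p.2 N,
                   forall k, k < N -> p.1 k = p.2 k,
                   p.1 N = p.2 N + 1 &
                   forall k, N < k -> p.1 k = 0]]].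

Definition component (p : (nat -> nat) * (nat -> nat)) : set (nat -> nat) :=
  [set h | h = p.1 \/ h = p.2].

Definition agree_pos (f g : nat -> nat) : Prop := forall k, 0 < k -> f k = g k.

Definition same_class (f g : nat -> nat) : Prop :=
  agree_pos f g /\ sigma f = sigma g.

Definition baseF (theta : nat -> nat) : set (set (nat -> nat)) :=
  [set b | exists2 p, W1 theta p &
     b = [set h | exists q, [/\ W1 theta q, same_class p.1 q.1 & component q h]]].

Definition W2 (theta : nat -> nat) : set (nat -> nat) :=
  [set h | primary theta h /\ ~ exists2 p, W1 theta p & component p h].

Definition baseG2 (theta : nat -> nat) : set (set (nat -> nat)) :=
  [set b | exists2 h, W2 theta h & b = [set g | W2 theta g /\ same_class h g]].

Definition base (theta : nat -> nat) : set (set (nat -> nat)) :=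
  baseF theta `|` baseG2 theta.

Definition real_of_base (theta : nat -> nat) (b : set (nat -> nat)) :
    set (nat -> nat) :=
  [set f | exists2 h, b h &
     forall N, 0 < N -> exists2 C, applicable theta C f &
       forall n, n <= N -> contractions theta C f n = h n].

Definition zero_fun : nat -> nat := fun=> 0.
Definition one_at_0 : nat -> nat := fun k => if k == 0 then 1 else 0.

Definition base_elem (theta h : nat -> nat) : set (nat -> nat) :=
  xget set0 [set b | base theta b /\ b h].

Definition zero_real (theta : nat -> nat) : set (nat -> nat) :=
  real_of_base theta (base_elem theta zero_fun) `|`
  real_of_base theta (base_elem theta one_at_0).

Definition reals (theta : nat -> nat) : set (set (nat -> nat)) :=
  [set real_of_base theta b | b in
     base theta `\` [set base_elem theta zero_fun; base_elem theta one_at_0]]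
  `|` [set zero_real theta].

Definition real_class (theta f : nat -> nat) : set (nat -> nat) :=
  xget set0 [set X | reals theta X /\ X f].

(* The common sign of the elements of a nonzero real number. *)
Definition real_sigma (X : set (nat -> nat)) : nat :=
  xget 0 [set s | forall f, X f -> sigma f = s].

Variant real_le (theta : nat -> nat) (X Y : set (nat -> nat)) : Prop :=
  | RealLeSign of X <> zero_real theta & Y <> zero_real theta
      & real_sigma X < real_sigma Y
  | RealLePos of X <> zero_real theta & Y <> zero_real theta
      & real_sigma X = 1 & real_sigma Y = 1
      & (forall a, X a -> exists2 b, Y b & forall n, 0 < n -> a n <= b n)
  | RealLeNeg of X <> zero_real theta & Y <> zero_real theta
      & real_sigma X = 0 & real_sigma Y = 0
      & (forall b, Y b -> exists2 a, X a & forall n, 0 < n -> b n <= a n)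
  | RealLeNeg0 of X <> zero_real theta & Y = zero_real theta & real_sigma X = 0
  | RealLe0Pos of X = zero_real theta & Y <> zero_real theta & real_sigma Y = 1
  | RealLe00 of X = zero_real theta & Y = zero_real theta.

Definition real_lt (theta : nat -> nat) (X Y : set (nat -> nat)) : Prop :=
  ~ real_le theta Y X.

Definition fun_abs (f : nat -> nat) : nat -> nat :=
  fun k => if k == 0 then 0 else f k.

Definition real_abs (theta : nat -> nat) (X : set (nat -> nat)) :
    set (nat -> nat) :=
  xget set0 [set Z | forall f, X f -> Z = real_class theta (fun_abs f)].

Definition tracking (theta f g : nat -> nat) : set (nat -> nat) :=
  [set r | exists w, [/\ real_class theta f w,
                         forall n, 0 < n -> g n <= w n,
                         r 0 = w 0 &
                         forall n, 0 < n -> r n = w n - g n]].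

Definition primary_rep (theta : nat -> nat) (X : set (nat -> nat)) : nat -> nat :=
  xget zero_fun [set h | X h /\ primary theta h].

Definition tracking_real (theta f g : nat -> nat) : set (nat -> nat) :=
  xget set0 [set X | reals theta X /\ tracking theta f g `<=` X].

Definition primary_tracking (theta f g : nat -> nat) : nat -> nat :=
  fun k => if k == 0 then f 0 else primary_rep theta (tracking_real theta f g) k.

(* As the order on real numbers is total, the final [else] is never reached
   when [f] and [g] are finite. *)
Definition sub_sum (theta f g : nat -> nat) : nat -> nat :=
  let af := real_abs theta (real_class theta f) in
  let ag := real_abs theta (real_class theta g) in
  if `[< [/\ sigma f = sigma g, ~ zero_real theta f & ~ zero_real theta g] >]
  then fun k => if k == 0 then f 0 * g 0 else f k + g k
  else if `[< af = ag >] then zero_fun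
  else if `[< real_lt theta ag af >] then primary_tracking theta f g
  else if `[< real_lt theta af ag >] then primary_tracking theta g f
  else zero_fun.

(* The common value of [f + g] over all representatives: independence of the
   representatives is not built in. *)
Definition real_add (theta : nat -> nat) (X Y : set (nat -> nat)) :
    set (nat -> nat) :=
  xget set0 [set Z | forall f g, X f -> Y g ->
                       Z = real_class theta (sub_sum theta f g)].

(* Main.v *)
Require Import Defs.
From mathcomp Require Import all_boot.
From mathcomp Require Import boolp classical_sets.
From mathcomp Require Import zify.

(** The neutral element is [[0]].  Scaling the finite sums
    [\sum_(1 <= k <= M) f k / (theta 1 ... theta (k-1))] to integers gives a quantity
    that a contraction can only increase, and only at index [M].  Hence the
    function [f] contracts to at most one function with normal digits, so that
    distinct real numbers are disjoint; and the elements of [[0]] vanish on the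
    positive integers, so that subtracting one of them changes nothing: the
    tracking functions of [g] against an element of [[0]] are exactly the
    elements of [[g]]. *)

Set Implicit Arguments.
Unset Strict Implicit.
Unset Printing Implicit Defensive.

Local Open Scope nat_scope.
Local Open Scope classical_set_scope.

Section Reals.

Variable theta : nat -> nat.

(** * Scaled partial sums and their behaviour under contractions *)

(** Horner form of the sum of the [f k / (theta 1 ... theta (k-1))] over [1 <= k <= M], multiplied
    by [theta 1 ... theta (M-1)]. *)
Fixpoint partial_value (M : nat) (f : nat -> nat) : nat :=
  if M is M'.+1 then theta M' * partial_value M' f + f M else 0.

(** A contraction trades [theta n] units at [n.+1] for one unit at [n]. For [n < M] both sides of
    the trade are counted and cancel, for [n > M] neither is, and for [n = M] only the gain is. *)
Lemma partial_value_contraction n M f : 0 < n -> contractible theta n f ->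
  partial_value M (contraction theta n f) = partial_value M f + (n == M).
Proof.
rewrite /contractible => n0 nf; elim: M => [|M IH] /=.
  by case: n n0 nf.
rewrite IH /contraction eqSS (eq_sym M.+1) (eq_sym M).
case: (eqVneq n M) => [<-|nM]; case: eqP => nM1; rewrite ?addn0 ?addn1; first lia.
- by rewrite mulnS; lia.
- by rewrite nM1; lia.
- by [].
Qed.

Lemma leq_partial_value_contractions C M f : applicable theta C f ->
  partial_value M f <= partial_value M (contractions theta C f).
Proof.
elim: C f => [//|n C IH] f /= /and3P[n0 nf /IH]; apply: leq_trans.
by rewrite partial_value_contraction // leq_addr.
Qed.

Lemma partial_value_contractions C M f : applicable theta C f ->
  (forall n, n \in C -> n < M) ->
  partial_value M (contractions theta C f) = partial_value M f.
Proof.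
elim: C f => [//|n C IH] f /= /and3P[n0 nf Cf] CM.
rewrite IH // => [|m mC]; last by apply: CM; rewrite inE mC orbT.
rewrite partial_value_contraction //.
by have := CM n (mem_head _ _); rewrite ltn_neqAle => /andP[/negbTE -> _]; lia.
Qed.

Lemma eq_partial_value M f g : (forall k, 0 < k <= M -> f k = g k) ->
  partial_value M f = partial_value M g.
Proof.
elim: M => [//|M IH] fg /=; rewrite IH ?fg //; first lia.
by move=> k kM; apply: fg; lia.
Qed.

Lemma leq_partial_value M f : 0 < M -> f M <= partial_value M f.
Proof. by case: M => // M _ /=; rewrite leq_addl. Qed.

(** A gap of at least 1 at level [M] grows to at least [theta M] at the next level, and the normal
    digit [f M.+1 < theta M] cannot close it. *)
Lemma ltn_partial_value k M f g : 0 < k -> normal_digits theta f -> k <= M ->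
  partial_value k f < partial_value k g -> partial_value M f < partial_value M g.
Proof.
move=> k0 nf + lt_k; elim: M => [|M IH]; first by case: k k0 lt_k.
rewrite leq_eqVlt => /orP[/eqP <-//|/[!ltnS] kM] /=.
have := nf M.+1 (leq_trans k0 kM); have := IH kM => /= lt_M fM.
have : theta M * (partial_value M f).+1 <= theta M * partial_value M g.
  by rewrite leq_mul2l lt_M orbT.
by rewrite mulnS; lia.
Qed.

(** * Uniqueness of the normal function to which [f] contracts *)

(** The membership condition of [real_of_base] for a fixed [h]; the sequence [C] may vary with
    [N]. *)
Definition contracts_to (f h : nat -> nat) : Prop :=
  forall N, 0 < N -> exists2 C, applicable theta C f &
    forall n, n <= N -> contractions theta C f n = h n.

Lemma contracts_to_refl f : contracts_to f f.
Proof. by move=> N _; exists [::]. Qed.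

Lemma contractions0 C f : applicable theta C f -> contractions theta C f 0 = f 0.
Proof.
elim: C f => [//|n C IH] f /= /and3P[n0 _ /IH ->].
by rewrite /contraction; case: n n0.
Qed.

Lemma contracts_to0 f h : contracts_to f h -> f 0 = h 0.
Proof. by move=> /(_ 1 isT)[C /contractions0 <-]; exact. Qed.

Lemma contracts_to_partial_value f h M : 0 < M -> contracts_to f h ->
  partial_value M f <= partial_value M h.
Proof.
move=> M0 /(_ M M0)[C Cf Ch].
rewrite -(@eq_partial_value M (contractions theta C f) h).
  exact: leq_partial_value_contractions.
by move=> k /andP[_]; exact: Ch.
Qed.

(** If [h k < h' k], a sequence [C] taking [f] to [h'] up to [k] gives a partial value above that of
    [h] at [k], hence at every later [M]. For large [M] this value is still that of [f], which
    cannot exceed that of [h]. *)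
Lemma contracts_to_digit_le f h h' k :
  contracts_to f h -> contracts_to f h' -> normal_digits theta h -> 0 < k ->
  (forall j, 0 < j < k -> h j = h' j) -> h' k <= h k.
Proof.
move=> fh fh' nh k0 hh'; rewrite leqNgt; apply/negP => hk.
have [C Cf Ch'] := fh' k k0.
(* [M] lies beyond every index in [C], so [C] preserves the partial value at [M]. *)
pose M := maxn k (\max_(n <- C) n).+1.
have kM : k <= M by exact: leq_maxl.
have M0 : 0 < M by exact: leq_trans kM.
have : partial_value k h < partial_value k (contractions theta C f).
  rewrite (@eq_partial_value k (contractions theta C f) h'); last first.
    by move=> j /andP[_]; exact: Ch'.
  case: k k0 hh' hk {Ch' M kM M0} => // k _ hh' hk /=.
  by rewrite (@eq_partial_value k h h') ?ltn_add2l // => j; exact: hh'.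
move=> /(ltn_partial_value k0 nh kM).
rewrite partial_value_contractions // ?ltnNge ?contracts_to_partial_value // => n nC.
by rewrite /M leq_max ltnS leq_bigmax_seq // orbT.
Qed.

Lemma contracts_to_inj f h h' : normal_digits theta h -> normal_digits theta h' ->
  contracts_to f h -> contracts_to f h' -> h = h'.
Proof.
move=> nh nh' fh fh'; apply/funext => k; elim/ltn_ind: k => -[_|k IH].
  by rewrite -(contracts_to0 fh) -(contracts_to0 fh').
apply/eqP; rewrite eqn_leq; apply/andP; split.
  by apply: (contracts_to_digit_le fh' fh) => // j /andP[_ jk]; rewrite IH.
by apply: (contracts_to_digit_le fh fh') => // j /andP[_ jk]; rewrite IH.
Qed.

(** * Changing the sign digit *)

(** Contractions have positive indices and never touch the digit at 0, so this operation commutes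
    with them. With [c = 0] it is [fun_abs]. *)
Definition set_digit0 (c : nat) (f : nat -> nat) : nat -> nat :=
  fun k => if k == 0 then c else f k.

Lemma set_digit0_pos c f k : 0 < k -> set_digit0 c f k = f k.
Proof. by case: k. Qed.

Lemma contraction_set_digit0 c n f : 0 < n ->
  contraction theta n (set_digit0 c f) = set_digit0 c (contraction theta n f).
Proof. by case: n => // n _; apply/funext => -[|k]. Qed.

Lemma applicable_set_digit0 c C f :
  applicable theta C (set_digit0 c f) = applicable theta C f.
Proof.
elim: C f => [//|n C IH] f /=; case: (posnP n) => // n0.
by rewrite contraction_set_digit0 // IH.
Qed.

Lemma contractions_set_digit0 c C f : applicable theta C f ->
  contractions theta C (set_digit0 c f) = set_digit0 c (contractions theta C f).
Proof.
elim: C f => [//|n C IH] f /= /and3P[n0 nf Cf].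
by rewrite contraction_set_digit0 // IH.
Qed.

Lemma contracts_to_set_digit0 c f h :
  contracts_to f h -> contracts_to (set_digit0 c f) (set_digit0 c h).
Proof.
move=> fh N /fh[C Cf Ch]; exists C; first by rewrite applicable_set_digit0.
by move=> [|n] nN; rewrite contractions_set_digit0 // /set_digit0 Ch.
Qed.

Lemma normal_set_digit0 c h :
  normal_digits theta h -> normal_digits theta (set_digit0 c h).
Proof. by move=> nh [|k] k2 //; exact: nh. Qed.

Lemma primary_set_digit0 c h : primary theta h -> primary theta (set_digit0 c h).
Proof.
move=> [nh ph]; split; first exact: normal_set_digit0.
by move=> N /ph[[//|M] NM hM]; exists M.+1.
Qed.

Lemma maximal_set_digit0 c h N :
  maximal_after theta (set_digit0 c h) N <-> maximal_after theta h N.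
Proof.
by split=> -[N0 hN]; split=> // -[|M] NM //; have := hN _ NM.
Qed.

Lemma W1_set_digit0 c p :
  W1 theta p -> W1 theta (set_digit0 c p.1, set_digit0 c p.2).
Proof.
move=> [pp [ns [M hM]] [N [[maxN minN] lt_N eq_N gt_N]]].
split=> /=; first exact: primary_set_digit0.
  by split; [exact: normal_set_digit0 | exists M; apply/maximal_set_digit0].
have N0 := maxN.1; exists N; split.
- split; first exact/maximal_set_digit0.
  by move=> N' /maximal_set_digit0; exact: minN.
- by move=> [|k] kN //; exact: lt_N.
- by rewrite !set_digit0_pos.
- by move=> [|k] // kN; exact: gt_N.
Qed.

Lemma W1_digit0 p : W1 theta p -> p.1 0 = p.2 0.
Proof. by move=> [_ _ [N [[[N0 _] _] lt_N _ _]]]; exact: lt_N. Qed.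

Lemma set_digit0K c h : set_digit0 (h 0) (set_digit0 c h) = h.
Proof. by apply/funext => -[]. Qed.

Lemma W2_set_digit0 c h : W2 theta h -> W2 theta (set_digit0 c h).
Proof.
move=> [ph hW1]; split; first exact: primary_set_digit0.
move=> [p /(W1_set_digit0 (h 0)) pW1 cp]; apply: hW1.
eexists; first exact: pW1.
by case: cp => <-; rewrite set_digit0K; [left | right].
Qed.

Lemma same_class_set_digit0 c f g :
  same_class f g -> same_class (set_digit0 c f) (set_digit0 c g).
Proof. by move=> [fg _]; split=> // -[|k] // k0; exact: fg. Qed.

Lemma same_class_digit0 c f : odd c = odd (f 0) -> same_class f (set_digit0 c f).
Proof. by rewrite /same_class /sigma /= => ->; split=> // -[]. Qed.

(** * Disjointness, signs and sign changes in the base set *)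

Lemma same_class_sym f g : same_class f g -> same_class g f.
Proof. by move=> [fg s]; split=> // k k0; rewrite fg. Qed.

Lemma same_class_trans f g h : same_class f g -> same_class g h -> same_class f h.
Proof. by move=> [fg s] [gh t]; split=> [k k0|]; rewrite ?fg ?gh // s. Qed.

Lemma primary_not_secondary h : primary theta h -> secondary theta h -> False.
Proof.
move=> [_ ph] [_ [N [N0 hN]]].
by have [M NM] := ph N N0; apply; exact: hN.
Qed.

(** The second component determines its least index [N], and with it every digit of the first
    component. *)
Lemma W1_snd_inj p q : W1 theta p -> W1 theta q -> p.2 = q.2 -> p.1 = q.1.
Proof.
move=> [_ _ [N [[maxN minN] ltN eqN gtN]]] [_ _ [M [[maxM minM] ltM eqM gtM]]] pq.
have NM : N = M.
  by apply/eqP; rewrite eqn_leq minN ?minM // -?pq // pq.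
subst M; apply/funext => k; case: (ltngtP k N) => [kN|kN|->].
- by rewrite ltN // ltM // pq.
- by rewrite gtN // gtM.
- by rewrite eqN eqM pq.
Qed.

Lemma base_normal b h : base theta b -> b h -> normal_digits theta h.
Proof.
move=> [[p _ ->] [q [[[pq _] [sq _] _] _ [->|->]]] //|[g _ ->] [[[//]]]].
Qed.

(** Inside [baseF], a shared function forces equal first components of the two pairs; [baseF] and
    [baseG2] cannot share one by the definition of [W2]. *)
Lemma base_inj b b' h : base theta b -> base theta b' -> b h -> b' h -> b = b'.
Proof.
move=> [[p pW ->]|[g gW ->]] [[p' pW' ->]|[g' gW' ->]].
- move=> [q [qW pq qh]] [q' [qW' pq' qh']].
  have qq' : q.1 = q'.1.
    (* The two mixed cases would make one function both primary and secondary. *)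
    case: qh qh' => -> [] e //; last exact: W1_snd_inj.
    - by case: qW qW' => prim _ _ [_ sec _]; rewrite e in prim; case: (primary_not_secondary prim).
    - by case: qW qW' => _ sec _ [prim _ _]; rewrite e in sec; case: (primary_not_secondary prim).
  have pp' : same_class p.1 p'.1.
    by apply: same_class_trans pq _; rewrite qq'; exact: same_class_sym.
  apply/seteqP; split=> k [r [rW pr rk]]; exists r; split=> //.
    exact: same_class_trans (same_class_sym pp') pr.
  exact: same_class_trans pp' pr.
- by move=> [q [qW _ qh]] [[_ []]]; exists q.
- by move=> [[_ hW] _] [q [qW _ qh]]; case: hW; exists q.
- move=> [_ gh] [_ gh']; have gg := same_class_trans gh (same_class_sym gh').
  apply/seteqP; split=> k [kW gk]; split=> //.
    exact: same_class_trans (same_class_sym gg) gk.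
  exact: same_class_trans gg gk.
Qed.

Lemma base_sigma b h h' : base theta b -> b h -> b h' -> sigma h = sigma h'.
Proof.
move=> [[p pW ->]|[g gW ->]]; last by move=> [_ [_ <-]] [_ [_ <-]].
have sq q : W1 theta q -> same_class p.1 q.1 -> forall k, component q k -> sigma k = sigma p.1.
  by move=> /W1_digit0 q0 [_ ->] k [->|->] //; rewrite /sigma q0.
by move=> [q [qW pq qh]] [q' [qW' pq' qh']]; rewrite (sq q) // (sq q').
Qed.

Lemma base_primary b : base theta b -> exists2 h, b h & primary theta h.
Proof.
move=> [[p pW ->]|[g gW ->]].
  by exists p.1; [exists p; split=> //; left | case: pW].
by exists g; [split | case: gW].
Qed.

Lemma base_set_digit0 c b : base theta b ->
  exists2 b', base theta b' & forall h, b h -> b' (set_digit0 c h).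
Proof.
move=> [[p pW ->]|[g gW ->]].
  eexists; first by left; eexists; [exact: (W1_set_digit0 c pW) | reflexivity].
  move=> h [q [qW pq qh]]; exists (set_digit0 c q.1, set_digit0 c q.2).
  split; [exact: W1_set_digit0 | exact: same_class_set_digit0 |].
  by case: qh => ->; [left | right].
eexists; first by right; eexists; [exact: (W2_set_digit0 c gW) | reflexivity].
by move=> h [hW gh]; split; [exact: W2_set_digit0 | exact: same_class_set_digit0].
Qed.

Lemma base_digit0 c b h : base theta b -> b h -> odd c = odd (h 0) ->
  b (set_digit0 c h).
Proof.
move=> [[p pW ->]|[g gW ->]].
  move=> [q [qW pq qh]] ch; exists (set_digit0 c q.1, set_digit0 c q.2).
  split; first exact: W1_set_digit0; last by case: qh => ->; [left | right].
  apply: same_class_trans pq _; apply: same_class_digit0.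
  by case: qh ch => -> //; rewrite (W1_digit0 qW).
move=> [hW gh] ch; split; first exact: W2_set_digit0.
by apply: same_class_trans gh _; exact: same_class_digit0.
Qed.

Lemma real_of_base_inj b b' f : base theta b -> base theta b' ->
  real_of_base theta b f -> real_of_base theta b' f -> b = b'.
Proof.
move=> Bb Bb' [h bh fh] [h' bh' fh'].
have hh' : h = h'.
  by apply: (contracts_to_inj _ _ fh fh'); [exact: base_normal bh | exact: base_normal bh'].
by apply: (base_inj Bb Bb' bh); rewrite hh'.
Qed.

Lemma real_of_base_sigma b f g : base theta b ->
  real_of_base theta b f -> real_of_base theta b g -> sigma f = sigma g.
Proof.
move=> Bb [h bh /contracts_to0 fh] [h' bh' /contracts_to0 gh'].
by rewrite /sigma fh gh'; exact: base_sigma bh bh'.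
Qed.

Hypothesis theta_ge2 : forall n, 0 < n -> 2 <= theta n.

(** * The real number zero *)

(** A first component of a pair in [W1] is positive at [N], and a second one ends in digits
    [theta (M-1) - 1 >= 1]; neither can vanish on the positive integers. *)
Lemma W2_zero h : agree_pos h zero_fun -> W2 theta h.
Proof.
move=> h0; split.
  split=> [[|[|k]] // _|N N0].
    by rewrite h0 //; apply: leq_trans (theta_ge2 _).
  exists N.+1 => //; rewrite h0 //= /zero_fun.
  by have := theta_ge2 N0; case: (theta N) => [|[]].
move=> [p [_ _ [N [[[N0 maxN] _] _ eqN _]]] [hp|hp]].
  by move: (h0 N N0); rewrite hp eqN /zero_fun; lia.
move: (h0 N.+1 isT) (theta_ge2 N0); rewrite hp maxN //= /zero_fun; lia.
Qed.

Lemma base_elemP h : agree_pos h zero_fun ->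
  base_elem theta h = [set g | agree_pos g zero_fun /\ sigma g = sigma h].
Proof.
move=> h0; set b := [set g | _].
have Bb : base theta b.
  right; exists h; first exact: W2_zero.
  apply/seteqP; split=> g.
    move=> [g0 gh]; split; first exact: W2_zero.
    by split=> // k k0; rewrite h0 // g0.
  by move=> [_ [gh sg]]; split=> // k k0; rewrite -gh // h0.
have bh : b h by [].
(* The class [b] shows that the default is not taken, and disjointness of classes identifies the
   chosen [b'] with [b]. *)
rewrite /base_elem; case: xgetP => [b' -> [Bb' bh']|/(_ b)[]//].
exact: base_inj bh' bh.
Qed.

Lemma base_elem_zero_fun :
  base_elem theta zero_fun = [set g | agree_pos g zero_fun /\ sigma g = 1].
Proof. exact: base_elemP. Qed.

Lemma base_elem_one_at_0 :
  base_elem theta one_at_0 = [set g | agree_pos g zero_fun /\ sigma g = 0].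
Proof. by apply: base_elemP => -[]. Qed.

Lemma zero_realP : zero_real theta = [set f | agree_pos f zero_fun].
Proof.
rewrite /zero_real base_elem_zero_fun base_elem_one_at_0; apply/seteqP; split=> f.
  have aux h : agree_pos h zero_fun -> contracts_to f h -> agree_pos f zero_fun.
    (* The digit [f k] is at most the partial value of [f], hence at most that of [h], which is
       0. *)
    move=> h0 fh k k0; apply/eqP; rewrite -leqn0.
    apply: leq_trans (leq_partial_value f k0) _.
    apply: leq_trans (contracts_to_partial_value k0 fh) _.
    rewrite (@eq_partial_value k h zero_fun); last by move=> j /andP[/h0].
    by elim: k {k0} => //= k; rewrite leqn0 => /eqP ->; rewrite muln0.
  by move=> [|] [h [h0 _]]; exact: aux.
(* Parity selects the class, and [f] contracts to itself by the empty sequence. *)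
move=> f0; case/boolP: (odd (f 0)) => s; [right | left].
  by exists f; [split=> //; rewrite /sigma s | exact: contracts_to_refl].
by exists f; [split=> //; rewrite /sigma (negbTE s) | exact: contracts_to_refl].
Qed.

Lemma base_neq_zero b h : base theta b -> b h -> ~ agree_pos h zero_fun ->
  ~ [set base_elem theta zero_fun; base_elem theta one_at_0] b.
Proof.
move=> Bb bh h0; rewrite base_elem_zero_fun base_elem_one_at_0.
by move=> [] e; apply: h0; move: bh; rewrite e => -[].
Qed.

Lemma nonzero_base b h : base theta b ->
  ~ [set base_elem theta zero_fun; base_elem theta one_at_0] b ->
  b h -> ~ agree_pos h zero_fun.
Proof.
move=> Bb b0 bh h0; apply: b0.
have Bz : base theta (base_elem theta h) /\ base_elem theta h h.
  have : [set b' | base theta b' /\ b' h] b by [].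
  exact: (xgetI set0).
have -> : b = base_elem theta h by exact: (base_inj Bb Bz.1 bh Bz.2).
rewrite base_elem_zero_fun base_elem_one_at_0 base_elemP // /sigma /=.
by case: (odd (h 0)); [right | left].
Qed.

(** A function vanishing on the positive integers is already normal, so it contracts only to itself
    and would have to lie in [b]. *)
Lemma nonzero_real_fun b f : base theta b ->
  ~ [set base_elem theta zero_fun; base_elem theta one_at_0] b ->
  real_of_base theta b f -> ~ zero_real theta f.
Proof.
move=> Bb b0 [h bh fh]; rewrite zero_realP /= => f0.
have ff := @contracts_to_refl f.
have fN : normal_digits theta f by have [[]] := W2_zero f0.
have e : f = h by apply: (contracts_to_inj fN _ ff fh); exact: base_normal bh.
by apply: (nonzero_base Bb b0 bh); rewrite -e.
Qed.

(** * Disjointness of real numbers and absolute values *)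

Lemma reals_disjoint X Y f :
  reals theta X -> reals theta Y -> X f -> Y f -> X = Y.
Proof.
move=> [[b [Bb b0] <-]|->] [[b' [Bb' b0'] <-]|->] //.
- by move=> bf bf'; rewrite (real_of_base_inj Bb Bb' bf bf').
- by move=> /(nonzero_real_fun Bb b0).
- by move=> + /(nonzero_real_fun Bb' b0').
Qed.

Lemma real_classE X f : reals theta X -> X f -> real_class theta f = X.
Proof.
move=> RX Xf; rewrite /real_class; case: xgetP => [Y -> [RY Yf]|/(_ X)[]//].
exact: reals_disjoint RY RX Yf Xf.
Qed.

Lemma zero_real_real : reals theta (zero_real theta).
Proof. by right. Qed.

Lemma zero_real_zero_fun : zero_real theta zero_fun.
Proof. by rewrite zero_realP. Qed.

Lemma real_primary A : reals theta A -> exists2 h, A h & primary theta h.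
Proof.
move=> [[b [Bb _] <-]|->].
  have [h bh ph] := base_primary Bb.
  by exists h => //; exists h => //; exact: contracts_to_refl.
exists zero_fun; first exact: zero_real_zero_fun.
by have [] : W2 theta zero_fun by exact: W2_zero.
Qed.

Lemma real_absE A Z f : A f -> (forall g, A g -> real_class theta (fun_abs g) = Z) ->
  real_abs theta A = Z.
Proof.
move=> Af AZ; rewrite /real_abs; case: xgetP => [Y -> /(_ f Af) ->|/(_ Z)[]].
  exact: AZ.
by move=> g /AZ.
Qed.

Lemma real_abs_zero : real_abs theta (zero_real theta) = zero_real theta.
Proof.
apply: (real_absE zero_real_zero_fun) => f; rewrite zero_realP => f0.
rewrite -zero_realP; apply: (real_classE zero_real_real); rewrite zero_realP.
by move=> [|k] // /f0.
Qed.

Lemma nonzero_reals A : reals theta A -> A <> zero_real theta ->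
  exists2 b, base theta b & A = real_of_base theta b /\
    ~ [set base_elem theta zero_fun; base_elem theta one_at_0] b.
Proof. by move=> [[b [Bb b0] <-]|->] // _; exists b. Qed.

Lemma real_sigmaE X f s : X f -> (forall g, X g -> sigma g = s) ->
  real_sigma X = s.
Proof.
move=> Xf Xs; rewrite /real_sigma; case: xgetP => [t -> /(_ f Xf) <-|/(_ s)[]//].
exact: Xs.
Qed.

(** Setting the digit at 0 to 0 sends [b] into a base class [b'] that is still nonzero, and the even
    digit 0 gives sign 1. *)
Lemma real_abs_nonzero A : reals theta A -> A <> zero_real theta ->
  real_abs theta A <> zero_real theta /\ real_sigma (real_abs theta A) = 1.
Proof.
move=> RA /(nonzero_reals RA)[b Bb [Ab b0]].
have [b' Bb' bb'] := base_set_digit0 0 Bb.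
have [h bh _] := base_primary Bb.
have hr : real_of_base theta b h by exists h => //; exact: contracts_to_refl.
have b0' : ~ [set base_elem theta zero_fun; base_elem theta one_at_0] b'.
  apply: (base_neq_zero Bb' (bb' h bh)) => h0.
  by apply: (nonzero_base Bb b0 bh) => -[|k] // /h0.
have absb f : real_of_base theta b f -> real_of_base theta b' (fun_abs f).
  by move=> [g /bb' bg /(contracts_to_set_digit0 0) fg]; exists (set_digit0 0 g).
have Rb' : reals theta (real_of_base theta b') by left; exists b'.
rewrite (@real_absE A (real_of_base theta b') h) ?Ab //; last first.
  by move=> g /absb; exact: real_classE.
split=> [b'0|]; first by apply: (nonzero_real_fun Bb' b0' (absb h hr)); rewrite -b'0; exact: absb.
apply: (real_sigmaE (absb h hr)) => g bg.
by rewrite (real_of_base_sigma Bb' bg (absb h hr)).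
Qed.

(** * Tracking functions and sums with zero *)

(** The primary tracking function has this shape: its digit at 0 and its remaining digits come from
    different members of [A]. For nonzero [A] these have the same parity at 0. *)
Lemma real_digit0 A f h : reals theta A -> A f -> A h -> A (set_digit0 (f 0) h).
Proof.
move=> [[b [Bb _] <-]|->]; last first.
  by rewrite zero_realP => f0 h0 [|k] // k0; exact: h0.
move=> bf bh; have : odd (f 0) = odd (h 0).
  by have := real_of_base_sigma Bb bf bh; rewrite /sigma; do 2!case: odd.
case: bh => k bk hk fh; exists (set_digit0 (f 0) k).
  by apply: base_digit0 => //; rewrite fh (contracts_to0 hk).
exact: contracts_to_set_digit0.
Qed.

Lemma tracking_zero A f g : reals theta A -> A g -> agree_pos f zero_fun ->
  tracking theta g f = A.
Proof.
move=> RA Ag f0; rewrite /tracking (real_classE RA Ag).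
apply/seteqP; split=> r /=.
  move=> [w [Aw _ r0 rw]]; suff -> : r = w by [].
  by apply/funext => -[//|k]; rewrite rw // f0 // /zero_fun subn0.
by move=> Ar; exists r; split=> // n n0; rewrite f0 // /zero_fun subn0.
Qed.

Lemma primary_tracking_zero A f g : reals theta A -> A g ->
  agree_pos f zero_fun -> A (primary_tracking theta g f).
Proof.
move=> RA Ag f0.
have trE : tracking_real theta g f = A.
  rewrite /tracking_real (tracking_zero RA Ag f0).
  case: xgetP => [X -> [RX /(_ g Ag) Xg]|/(_ A)[]]; last by split=> // x.
  exact: reals_disjoint RX RA Xg Ag.
have [h Ah ph] := real_primary RA.
have [Ar _] : [set h | A h /\ primary theta h] (primary_rep theta A).
  by apply: (@xgetI _ zero_fun _ h).
by rewrite /primary_tracking trE; exact: (real_digit0 RA Ag Ar).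
Qed.

Lemma sub_sum_zero A f g : reals theta A -> zero_real theta f -> A g ->
  A (sub_sum theta f g).
Proof.
move=> RA Zf Ag; rewrite /sub_sum (real_classE zero_real_real Zf) (real_classE RA Ag).
(* The branch of equal signs is excluded, since [f] lies in zero. *)
case: asboolP => [[] //|_].
have [->|A0] := pselect (A = zero_real theta).
  by case: asboolP => // _; exact: zero_real_zero_fun.
rewrite real_abs_zero; have [aA sA] := real_abs_nonzero RA A0.
case: asboolP => [/esym //|_].
(* As [|A|] is nonzero of sign 1, zero is strictly below it, which selects the primary tracking
   function of [g] against [f]. *)
case: asboolP => [[]|_]; first exact: RealLe0Pos.
case: asboolP => [_|[]]; first by apply: primary_tracking_zero => //; move: Zf; rewrite zero_realP.
by case=> //; rewrite sA.
Qed.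

Lemma real_add0 A : reals theta A -> real_add theta (zero_real theta) A = A.
Proof.
move=> RA; have [g Ag _] := real_primary RA.
have sumE f k : zero_real theta f -> A k -> real_class theta (sub_sum theta f k) = A.
  by move=> Zf Ak; apply: real_classE => //; exact: sub_sum_zero.
(* [zero_fun] and [g] show that both summands are inhabited, so the common value [Z] is forced. *)
rewrite /real_add; case: xgetP => [Z -> /(_ _ _ zero_real_zero_fun Ag) ->|/(_ A)[]].
  exact: sumE zero_real_zero_fun Ag.
by move=> f k Zf Ak; rewrite sumE.
Qed.

End Reals.

Theorem mainTheorem7 (theta : nat -> nat)
    (theta_ge2 : forall n : nat, 0 < n -> 2 <= theta n) :
  exists2 X : set (nat -> nat), reals theta X &
    forall A : set (nat -> nat), reals theta A -> real_add theta X A = A.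
Proof.
exists (zero_real theta); first exact: zero_real_real.
by move=> A; exact: real_add0.
Qed.
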